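(* Let $(\Sigma,\partial)$ be a differential field whose field of constants $\mathbf{C}$ is algebraically closed and of characteristic zero. Let $L\in\Sigma[\partial]\setminus\mathbf{C}[\partial]$ be a third order operator with nontrivial centralizer $\mathcal{Z}(L)$. Then the ideal $\mathrm{BC}(L)$ is a prime ideal in $\mathbf{C}[\lambda,\mu_1,\mu_2]$.
   Context: $\Sigma[\partial]$ is the ring of differential operators with coefficients in $\Sigma$ ($\partial a=a\partial+\partial(a)$). $\mathcal{Z}(L)=\{A\in\Sigma[\partial]\mid LA=AL\}$ is the centralizer of $L$; it is a commutative domain, and it is called nontrivial if $\mathcal{Z}(L)\neq\mathbf{C}[L]$. In that case $\mathcal{Z}(L)$ is a free $\mathbf{C}[L]$-module of rank $3$; a basis $\{1,A_1,A_2\}$ is fixed, with $A_i$ of minimal order among the elements of $\mathcal{Z}(L)$ of order congruent to $i$ modulo $3$. The Burchnall–Chaundy ideal of $L$ is $\mathrm{BC}(L)=\{g\in\mathbf{C}[\lambda,\mu_1,\mu_2]\mid g(L,A_1,A_2)=0\}$, the kernel of the ring homomorphism $\mathbf{C}[\lambda,\mu_1,\mu_2]\to\Sigma[\partial]$, $\lambda\mapsto L$, $\mu_1\mapsto A_1$, $\mu_2\mapsto A_2$. *)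

(* Defs.v *)
From HB Require Import structures.
From mathcomp Require Import all_boot all_algebra.
From mathcomp Require Export mpoly.

Set Implicit Arguments.
Unset Strict Implicit.
Unset Printing Implicit Defensive.

Import GRing.Theory.
Local Open Scope ring_scope.

HB.mixin Record isDifferential F of GRing.Field F := {
  der : F -> F;
  derD : {morph der : x y / x + y};
  derM : forall x y : F, der (x * y) = der x * y + x * der y
}.

#[short(type="diffFieldType")]
HB.structure Definition DiffField := {F of isDifferential F & GRing.Field F}.

Section Constants.
Variable F : diffFieldType.
Implicit Types x y : F.

Lemma der0 : der (0 : F) = 0.
Proof. by apply: (addrI (der 0)); rewrite -derD !addr0. Qed.

Lemma der1 : der (1 : F) = 0.
Proof. by apply: (addrI (der 1)); rewrite -{3}[1]mulr1 derM mulr1 mul1r addr0. Qed.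

Lemma derN x : der (- x) = - der x.
Proof. by apply: (addrI (der x)); rewrite -derD !subrr der0. Qed.

Definition is_const : {pred F} := fun x => der x == 0.

Lemma is_constE x : (x \in is_const) = (der x == 0).
Proof. by []. Qed.

Fact const_divring_closed : divring_closed is_const.
Proof.
split=> [|x y|x y]; rewrite !is_constE; first by rewrite der1.
  by move=> /eqP dx /eqP dy; rewrite derD derN dx dy subr0.
move=> /eqP dx /eqP dy; rewrite derM dx mul0r add0r mulf_eq0.
have [->|y0] := eqVneq y 0; first by rewrite invr0 der0 eqxx orbT.
have /eqP : der (y * y^-1) = 0 by rewrite divff // der1.
by rewrite derM dy mul0r add0r mulf_eq0 (negPf y0) /= => ->; rewrite orbT.
Qed.

HB.instance Definition _ := GRing.isDivringClosed.Build F is_const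
  const_divring_closed.

Record constants := Const { const_val :> F; const_valP : const_val \in is_const }.

HB.instance Definition _ := [isSub for const_val].
HB.instance Definition _ := [Choice of constants by <:].
HB.instance Definition _ := [SubChoice_isSubIntegralDomain of constants by <:].
HB.instance Definition _ := [SubIntegralDomain_isSubField of constants by <:].

End Constants.
Arguments is_const {F}.

(* The ring F[d] of differential operators.  The operator                     *)
(* \sum_i a_i d^i is encoded by the polynomial \sum_i a_i 'X^i in a wrapper   *)
(* type, so that it does not inherit the commutative product of {poly F}.     *)

Record diffop (F : diffFieldType) := DiffOp { dpoly : {poly F} }.

Section DiffOp.
Variable F : diffFieldType.
Implicit Types (p q r : {poly F}) (A B C : diffop F).

HB.instance Definition _ := [isNew for @dpoly F].
HB.instance Definition _ := [Choice of diffop F by <:].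

Definition dop_add A B := DiffOp (dpoly A + dpoly B).
Definition dop_opp A := DiffOp (- dpoly A).

Fact dop_addA : associative dop_add.
Proof. by move=> A B C; congr DiffOp; apply: addrA. Qed.
Fact dop_addC : commutative dop_add.
Proof. by move=> A B; congr DiffOp; apply: addrC. Qed.
Fact dop_add0 : left_id (DiffOp 0) dop_add.
Proof. by case=> p; congr DiffOp; apply: add0r. Qed.
Fact dop_addN : left_inverse (DiffOp 0) dop_opp dop_add.
Proof. by case=> p; congr DiffOp; apply: addNr. Qed.

HB.instance Definition _ := GRing.isZmodule.Build (diffop F)
  dop_addA dop_addC dop_add0 dop_addN.

(* Left multiplication by d: d (\sum_j b_j d^j) = \sum_j (b_j d + d(b_j)) d^j *)
Definition dmulX q : {poly F} := q * 'X + map_poly der q.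

Definition dmul p q : {poly F} := \sum_(i < size p) p`_i *: iter i dmulX q.

Lemma dmulE n p q : (size p <= n)%N ->
  dmul p q = \sum_(i < n) p`_i *: iter i dmulX q.
Proof.
move=> le_pn; rewrite /dmul (big_ord_widen n (fun i => p`_i *: iter i dmulX q)) //.
rewrite big_mkcond; apply: eq_bigr => i _; case: ltnP => // /(nth_default 0) ->.
by rewrite scale0r.
Qed.

Lemma coef_map_der p i : (map_poly der p)`_i = der p`_i.
Proof. by rewrite coef_map_id0 // der0. Qed.

Lemma dmulXD : {morph dmulX : p q / p + q}.
Proof.
move=> p q; rewrite /dmulX mulrDl addrACA; congr (_ + _).
by apply/polyP=> i; rewrite coefD !coef_map_der coefD derD.
Qed.

Lemma dmulX0 : dmulX 0 = 0.
Proof. by rewrite /dmulX mul0r add0r; apply/polyP=> i; rewrite coef_map_der coef0 der0. Qed.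

Lemma dmulX_sum I (s : seq I) (P : pred I) (G : I -> {poly F}) :
  dmulX (\sum_(i <- s | P i) G i) = \sum_(i <- s | P i) dmulX (G i).
Proof. exact: (big_morph _ dmulXD dmulX0). Qed.

Lemma dmulXZ a q : dmulX (a *: q) = a *: dmulX q + der a *: q.
Proof.
rewrite /dmulX -scalerAl scalerDr -addrA; congr (_ + _).
apply/polyP=> i; rewrite coefD !coefZ !coef_map_der coefZ derM addrC.
by congr (_ + _).
Qed.

Lemma iter_dmulXD n : {morph iter n dmulX : p q / p + q}.
Proof. by move=> p q; elim: n => //= n ->; rewrite dmulXD. Qed.

Lemma dmulDl : left_distributive dmul +%R.
Proof.
move=> p q r; pose n := maxn (size (p + q)) (maxn (size p) (size q)).
rewrite !(@dmulE n) ?leq_max ?leqnn ?orbT // -big_split /=.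
by apply: eq_bigr => i _; rewrite coefD scalerDl.
Qed.

Lemma dmulDr : right_distributive dmul +%R.
Proof.
move=> p q r; rewrite /dmul -big_split /=.
by apply: eq_bigr => i _; rewrite iter_dmulXD scalerDr.
Qed.

Lemma dmul0l r : dmul 0 r = 0.
Proof. by rewrite /dmul size_poly0 big_ord0. Qed.

Lemma dmulZl a q r : dmul (a *: q) r = a *: dmul q r.
Proof.
rewrite !(@dmulE (size q)) ?size_scale_leq // scaler_sumr.
by apply: eq_bigr => i _; rewrite coefZ scalerA.
Qed.

Lemma dmul_suml I (s : seq I) (P : pred I) (G : I -> {poly F}) r :
  dmul (\sum_(i <- s | P i) G i) r = \sum_(i <- s | P i) dmul (G i) r.
Proof.
by apply: (big_morph (fun p => dmul p r)); [move=> x y; apply: dmulDl|apply: dmul0l].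
Qed.

Lemma dmul_dmulX q r : dmul (dmulX q) r = dmulX (dmul q r).
Proof.
have szX : (size (q * 'X)%R <= (size q).+1)%N.
  by rewrite (leq_trans (size_polyMleq _ _)) // size_polyX addn2.
have szd : (size (map_poly der q) <= size q)%N by apply: size_poly.
rewrite {1}/dmulX dmulDl (dmulE r szX) (dmulE r szd).
rewrite big_ord_recl coefMX eqxx scale0r add0r /dmul dmulX_sum -big_split /=.
apply: eq_bigr => i _; rewrite coefMX coef_map_der dmulXZ /=.
by [].
Qed.

Lemma dmulA : associative dmul.
Proof.
move=> p q r; rewrite [dmul p q]/dmul dmul_suml {1}/dmul; apply: eq_bigr => i _.
rewrite dmulZl; congr (_ *: _).
by elim: (nat_of_ord i) => //= n ->; rewrite dmul_dmulX.
Qed.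

Definition dop_mul A B := DiffOp (dmul (dpoly A) (dpoly B)).

Fact dop_mulA : associative dop_mul.
Proof. by move=> A B C; congr DiffOp; apply: dmulA. Qed.

Fact dop_mul1l : left_id (DiffOp 1) dop_mul.
Proof.
by case=> q; congr DiffOp; rewrite /dmul size_poly1 big_ord1 coef1 scale1r.
Qed.

Lemma iter_dmulX1 n : iter n dmulX 1 = 'X^n.
Proof.
elim: n => [|n IHn] /=; first by rewrite expr0.
rewrite IHn /dmulX -exprSr; apply/polyP=> i.
rewrite coefD coef_map_der !coefXn.
by case: (i == n); rewrite ?der1 ?der0 addr0.
Qed.

Fact dop_mul1r : right_id (DiffOp 1) dop_mul.
Proof.
case=> p; congr DiffOp; rewrite /dmul -[RHS]coefK poly_def.
by apply: eq_bigr => i _; rewrite iter_dmulX1.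
Qed.

Fact dop_mulDl : left_distributive dop_mul dop_add.
Proof. by move=> A B C; congr DiffOp; apply: dmulDl. Qed.

Fact dop_mulDr : right_distributive dop_mul dop_add.
Proof. by move=> A B C; congr DiffOp; apply: dmulDr. Qed.

Fact dop_1neq0 : DiffOp 1 != 0 :> diffop F.
Proof. by apply/eqP=> -[] /eqP; rewrite oner_eq0. Qed.

HB.instance Definition _ := GRing.Zmodule_isNzRing.Build (diffop F)
  dop_mulA dop_mul1l dop_mul1r dop_mulDl dop_mulDr dop_1neq0.

Definition dconst (a : F) : diffop F := DiffOp a%:P.
Definition dX : diffop F := DiffOp 'X.

Fact dconst_is_zmod_morphism : zmod_morphism dconst.
Proof. by move=> a b; congr DiffOp; rewrite polyCB. Qed.

Lemma dmulC a q : dmul a%:P q = a *: q.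
Proof. by rewrite (@dmulE 1) ?size_polyC_leq1 // big_ord1 coefC. Qed.

Fact dconst_is_monoid_morphism : monoid_morphism dconst.
Proof.
by split=> // a b; congr DiffOp; rewrite dmulC polyCM mul_polyC.
Qed.

HB.instance Definition _ := GRing.isZmodMorphism.Build F (diffop F) dconst
  dconst_is_zmod_morphism.
HB.instance Definition _ := GRing.isMonoidMorphism.Build F (diffop F) dconst
  dconst_is_monoid_morphism.

Lemma dmulXl q : dmul 'X q = dmulX q.
Proof.
rewrite /dmul size_polyX !big_ord_recl big_ord0 !coefX.
by rewrite scale0r add0r addr0 scale1r.
Qed.

Lemma dX_comm a : dX * dconst a = dconst a * dX + dconst (der a).
Proof.
congr DiffOp; rewrite /= dmulXl dmulC /dmulX mul_polyC; congr (_ + _).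
by apply/polyP=> i; rewrite coef_map_der !coefC; case: eqP; rewrite // der0.
Qed.

Lemma dpoly_dXn i : dpoly (dX ^+ i) = 'X^i.
Proof.
elim: i => [|i IHi]; first by rewrite !expr0.
by rewrite exprS /= dmulXl IHi -!iter_dmulX1.
Qed.

Lemma diffopE A : A = \sum_(i < size (dpoly A)) dconst (dpoly A)`_i * dX ^+ i.
Proof.
apply: val_inj => /=; rewrite (big_morph (@dpoly F) (id1 := 0) (op1 := +%R)) //.
rewrite -[LHS]coefK poly_def; apply: eq_bigr => i _ /=.
by rewrite dmulC dpoly_dXn.
Qed.

End DiffOp.
Arguments dconst {F}.
Arguments dX {F}.

Section Centralizer.
Variable F : diffFieldType.
Local Notation K := (constants F).
Implicit Types (L A B Q : diffop F).

(* The order, for a nonzero operator; ord 0 = 0. *)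
Definition ord A : nat := (size (dpoly A)).-1.

(* A lies in the subring K[d]. *)
Definition const_coef A : Prop := forall i, (dpoly A)`_i \in is_const.

Definition kconst : K -> diffop F := dconst \o val.
HB.instance Definition _ := GRing.RMorphism.on kconst.

Definition centralizer L A : Prop := L * A = A * L.

Definition poly_in L A : Prop :=
  exists p : {poly K}, A = (map_poly kconst p).[L].

Definition nontrivial_centralizer L : Prop :=
  ~ (forall A, centralizer L A <-> poly_in L A).

(* {1, A1, A2} is a basis of the left K[L]-module Z(L), where K[L] is poly_in L. *)
Definition centralizer_basis L A1 A2 : Prop :=
  [/\ centralizer L A1, centralizer L A2,
      forall A, centralizer L A -> exists Q0 Q1 Q2,
        [/\ poly_in L Q0, poly_in L Q1, poly_in L Q2
          & A = Q0 + Q1 * A1 + Q2 * A2]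
    & forall Q0 Q1 Q2, poly_in L Q0 -> poly_in L Q1 -> poly_in L Q2 ->
        Q0 + Q1 * A1 + Q2 * A2 = 0 -> [/\ Q0 = 0, Q1 = 0 & Q2 = 0]].

Definition min_order_mod3 L (i : nat) A : Prop :=
  [/\ centralizer L A, ord A = i %[mod 3]
    & forall B, centralizer L B -> ord B = i %[mod 3] -> (ord A <= ord B)%N].

(* The variables lambda, mu_1, mu_2 of K[lambda, mu_1, mu_2] are 'X_0, 'X_1,  *)
(* 'X_2 in {mpoly K[3]}; mmap substitutes the ordered monomials L^i A1^j A2^k. *)
Definition BC_eval L A1 A2 (g : {mpoly K[3]}) : diffop F :=
  mmap kconst (tnth [tuple L; A1; A2]) g.

Definition BC L A1 A2 : {pred {mpoly K[3]}} :=
  fun g => BC_eval L A1 A2 g == 0.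

End Centralizer.

(* Main.v *)
Require Import Defs.
From mathcomp Require Import all_boot all_algebra.
From mathcomp Require Import mpoly.
From mathcomp Require Import zify.

(** The ideal BC(L) is the kernel of the evaluation g |-> g(L, A1, A2).  If
    this evaluation is a ring morphism into a ring without zero divisors, its
    kernel is prime.  Two facts are needed for that.

    First, F[d] has no zero divisors, because the order of a product is the sum
    of the orders (size_dmul, ord_mul, diffop_mulf_eq0).

    Second, the evaluation is multiplicative as soon as L, A1 and A2 commute
    pairwise (mmap_mulr_comm): the coefficients are constants, hence central
    (kconst_central).  Commutation with L is given, and A1 A2 = A2 A1 is the
    heart of the matter (centralizer_basis_comm).  Expand the square of A1 in
    the K[L]-basis {1, A1, A2} of Z(L):
      A1^2 = Q0 + Q1 A1 + Q2 A2   with Q0, Q1, Q2 in K[L].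
    Every element of K[L] has order divisible by 3 (ord_poly_in), and A1 has
    order 1 modulo 3; so A1^2 has order 2 modulo 3, while Q0 + Q1 A1 has order 0
    or 1 modulo 3.  Hence Q2 is nonzero.  But Q2 A2 = A1^2 - Q0 - Q1 A1 commutes
    with A1, and so does Q2; therefore Q2 (A1 A2 - A2 A1) = 0, and Q2 can be
    cancelled. *)

Set Implicit Arguments.
Unset Strict Implicit.
Unset Printing Implicit Defensive.

Import GRing.Theory.
Local Open Scope ring_scope.

Section Order.
Variable F : diffFieldType.
Implicit Types (p q : {poly F}) (A B L : diffop F).

Lemma size_dmulX q : q != 0 -> size (dmulX q) = (size q).+1.
Proof.
move=> q0; rewrite /dmulX size_polyDl size_mulX // ltnS; exact: size_poly.
Qed.

Lemma size_iter_dmulX n q : q != 0 -> size (iter n (@dmulX F) q) = (n + size q)%N.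
Proof.
move=> q0; elim: n => //= n IHn.
by rewrite size_dmulX ?IHn // -size_poly_gt0 IHn addn_gt0 size_poly_gt0 q0 orbT.
Qed.

(** Moving d past a coefficient only creates terms of lower order, so the
    leading term of a product is the product of the leading terms. *)
Lemma size_dmul p q : p != 0 -> q != 0 ->
  size (dmul p q) = (size p + size q).-1.
Proof.
move=> p0 q0; have lc : p`_(size p).-1 != 0 by rewrite -lead_coefE lead_coef_eq0.
have lp : (0 < size p)%N by rewrite size_poly_gt0.
have lq : (0 < size q)%N by rewrite size_poly_gt0.
rewrite /dmul; case: (size p) lp lc => // n _ /= lc.
have st : size (p`_n *: iter n (@dmulX F) q) = (n + size q)%N.
  by rewrite size_scale // size_iter_dmulX.
rewrite big_ord_recr /= addrC size_polyDl st // (leq_ltn_trans (size_sum _ _ _)) //.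
rewrite -(@prednK (n + size q)) ?addn_gt0 ?lq ?orbT // ltnS.
apply/bigmax_leqP => i _; apply: leq_trans (size_scale_leq _ _) _.
rewrite size_iter_dmulX // -ltnS prednK ?addn_gt0 ?lq ?orbT //.
by rewrite ltn_add2r.
Qed.

Lemma dpoly_eq0 A : (dpoly A == 0) = (A == 0).
Proof. by []. Qed.

Lemma ord_diffop0 : ord (0 : diffop F) = 0%N.
Proof. by rewrite /ord size_poly0. Qed.

Lemma diffop_mulf_eq0 A B : (A * B == 0) = (A == 0) || (B == 0).
Proof.
have [->|A0] := eqVneq A 0; first by rewrite mul0r eqxx.
have [->|B0] := eqVneq B 0; first by rewrite mulr0 eqxx.
rewrite -dpoly_eq0 -size_poly_eq0 size_dmul // -subn1 subn_eq0 leqNgt.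
have: (0 < size (dpoly A))%N && (0 < size (dpoly B))%N.
  by rewrite !size_poly_gt0 !dpoly_eq0 A0.
by case/andP; case: (size _) => // m _; case: (size _) => // n _; rewrite addnS.
Qed.

Lemma ord_mul A B : A != 0 -> B != 0 -> ord (A * B) = (ord A + ord B)%N.
Proof.
move=> A0 B0; rewrite /ord size_dmul //.
have: (0 < size (dpoly A))%N && (0 < size (dpoly B))%N.
  by rewrite !size_poly_gt0 !dpoly_eq0 A0.
case/andP; case: (size _) => // m _; case: (size _) => // n _.
by rewrite addnS.
Qed.

Lemma ord_add_leq A B : (ord (A + B)%R <= maxn (ord A) (ord B))%N.
Proof.
have := size_polyD (dpoly A) (dpoly B).
by rewrite /ord /= !leq_max; lia.
Qed.

(** No cancellation of leading terms can occur. The convention ord 0 = 0 does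
    no harm: if one summand is 0, the other one has positive order. *)
Lemma ord_add_neq A B : ord A != ord B -> ord (A + B) = maxn (ord A) (ord B).
Proof.
wlog ltAB : A B / (ord A < ord B)%N => [H|_].
  rewrite neq_ltn => /orP[lt|lt]; first by rewrite H // neq_ltn lt.
  by rewrite addrC maxnC H // neq_ltn lt.
have lt : (size (dpoly A) < size (dpoly B))%N.
  by move: ltAB; rewrite /ord; case: (size _) => [|m]; case: (size _).
by rewrite (maxn_idPr (ltnW ltAB)) /ord addrC [dpoly _]/= size_polyDl.
Qed.

End Order.

Section Commutation.
Variable F : diffFieldType.
Local Notation K := (constants F).
Implicit Types (A B C L : diffop F).

(** Constants commute with F because F is commutative, and with d because their
    derivative vanishes. *)
Lemma kconst_central (c : K) A : GRing.comm (kconst c) A.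
Proof.
have dc : der (val c) = 0 by apply/eqP; apply: (valP c).
have dmulXc n q : iter n (@dmulX F) (val c *: q) = val c *: iter n (@dmulX F) q.
  by elim: n => //= n ->; rewrite dmulXZ dc scale0r addr0.
have /(congr1 (@dpoly F)) /= dmul1 := mulr1 A.
congr DiffOp; rewrite /= dmulC -{1}dmul1 -alg_polyC /dmul scaler_sumr.
by apply: eq_bigr => i _; rewrite dmulXc !scalerA mulrC.
Qed.

Lemma poly_in_comm L A B : poly_in L A -> GRing.comm B L -> GRing.comm B A.
Proof.
case=> p -> BL; apply: commr_horner => // i.
by rewrite coef_map; apply: kconst_central.
Qed.

(** By Horner's scheme, p(L) is built up from 0 by steps A |-> A L + c with c
    constant; each step adds ord L to the order or yields an operator of order
    0. *)
Lemma ord_poly_in L A : poly_in L A -> (ord L %| ord A)%N.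
Proof.
have ordc (c : K) : ord (kconst c) = 0%N.
  by rewrite /ord /= size_polyC; case: eqP.
case=> p ->; elim/poly_ind: p => [|p c]; first by rewrite rmorph0 horner0 ord_diffop0.
rewrite rmorphD rmorphM /= map_polyX map_polyC /= hornerMXaddC.
move: (_.[L]) => B IH.
have dvdBL : (ord L %| ord (B * L)%R)%N.
  have [->|B0] := eqVneq B 0; first by rewrite mul0r ord_diffop0.
  have [->|L0] := eqVneq L 0; first by rewrite mulr0 ord_diffop0.
  by rewrite ord_mul // dvdn_addl.
have [e|BL0] := eqVneq (ord (B * L)) 0%N.
  have := ord_add_leq (B * L) (kconst c).
  by rewrite e ordc maxnn leqn0 => /eqP ->.
by rewrite ord_add_neq ordc // maxn0.
Qed.

(** If A2 does not occur in the expansion of A1^2, the two sides have different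
    orders modulo 3; so A2 can be solved for, up to a left factor in K[L]. *)
Lemma centralizer_basis_comm L A1 A2 : ord L = 3%N -> ord A1 = 1 %[mod 3] ->
  centralizer_basis L A1 A2 -> GRing.comm A1 A2.
Proof.
move=> ordL ordA1 [LA1 LA2 gen _].
have A10 : A1 != 0 by apply: contra_eq_neq ordA1 => ->; rewrite ord_diffop0.
have LA1A1 : centralizer L (A1 * A1).
  by rewrite /centralizer mulrA LA1 -!mulrA LA1.
have [Q0 [Q1 [Q2 [Q0L Q1L Q2L eA]]]] := gen _ LA1A1.
have Q20 : Q2 != 0.
  apply/eqP => Q20; move: eA; rewrite Q20 mul0r addr0 => /(congr1 (@ord F)).
  have := ord_poly_in Q0L; have := ord_poly_in Q1L; rewrite ordL ord_mul //.
  have [->|Q10] := eqVneq Q1 0; first by rewrite mul0r addr0; lia.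
  have := ord_mul Q10 A10 => eQ1 dQ1 dQ0; rewrite ord_add_neq eQ1; last lia.
  lia.
have commQ Q : poly_in L Q -> GRing.comm A1 Q by move/poly_in_comm; apply.
have: GRing.comm A1 (Q2 * A2).
  have -> : Q2 * A2 = A1 * A1 - (Q0 + Q1 * A1) by rewrite eA [_ + Q2 * _]addrC addrK.
  apply: commrB; first exact: commrM.
  by apply: commrD; [apply: commQ|apply: commrM => //; apply: commQ].
rewrite /GRing.comm mulrA (commQ _ Q2L) -!mulrA => /eqP.
rewrite -subr_eq0 -mulrBr diffop_mulf_eq0 (negPf Q20) /= subr_eq0.
by move/eqP.
Qed.

End Commutation.

(** When the values h i commute with each other, ordered monomials in them
    multiply as in a commutative ring, and central coefficients can be moved
    past them; so substitution is multiplicative although S need not be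
    commutative. *)
Lemma mmap_mulr_comm (n : nat) (R S : nzRingType) (f : {rmorphism R -> S})
    (h : 'I_n -> S) :
  (forall c x, GRing.comm (f c) x) -> (forall i j, GRing.comm (h i) (h j)) ->
  {morph mmap f h : p q / p * q}.
Proof.
move=> fC hC p q; rewrite [p in LHS]mpolyE [q in LHS]mpolyE.
rewrite [mmap f h p]/mmap [mmap f h q]/mmap.
rewrite !mulr_suml raddf_sum /=; apply: eq_bigr => m _.
rewrite !mulr_sumr raddf_sum /=; apply: eq_bigr => m' _.
rewrite -!mul_mpolyC mulrA -[_ * 'X_[m] * _]mulrA -commr_mpolyX.
rewrite !mulrA -mpolyCM -mulrA -mpolyXD mul_mpolyC mmapZ mmapX rmorphM.
have -> : mmap1 h (m + m') = mmap1 h m * mmap1 h m'.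
  rewrite /mmap1 -prodrM_comm => [|i j _ _]; last exact/commrX/commr_sym/commrX.
  by apply: eq_bigr => i _; rewrite mnmDE exprD.
by rewrite -!mulrA; congr (_ * _); rewrite !mulrA fC.
Qed.

Theorem lemma3p7 (F : diffFieldType)
    (Kclosed : GRing.closed_field_axiom (constants F))
    (Kchar0 : [pchar (constants F)] =i pred0)
    (L A1 A2 : diffop F)
    (ordL : ord L = 3%N)
    (Lnconst : ~ const_coef L)
    (ZLnontriv : nontrivial_centralizer L)
    (A12basis : centralizer_basis L A1 A2)
    (A1min : min_order_mod3 L 1 A1)
    (A2min : min_order_mod3 L 2 A2) :
  idealr_closed (BC L A1 A2) /\ prime_idealr_closed (BC L A1 A2).
Proof.
have [_ ordA1 _] := A1min; have [LA1 LA2 _ _] := A12basis.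
have A12 := centralizer_basis_comm ordL ordA1 A12basis.
have hC i j : GRing.comm (tnth [tuple L; A1; A2] i) (tnth [tuple L; A1; A2] j).
  by case: i j => [[|[|[|//]]] ?] [[|[|[|//]]] ?].
have evM := mmap_mulr_comm (@kconst_central F) hC.
have BCE g : (g \in BC L A1 A2) = (BC_eval L A1 A2 g == 0) by [].
split; first split.
- by rewrite BCE /BC_eval mmap0.
- by rewrite BCE /BC_eval mmapC /= rmorph1 oner_eq0.
- move=> a u v; rewrite !BCE /BC_eval => /eqP u0 /eqP v0.
  by rewrite mmapD evM u0 v0 mulr0 addr0.
- by move=> u v; rewrite !BCE /BC_eval evM diffop_mulf_eq0.
Qed.
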